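(* Let $f:\mathbb{R}^n\to\mathbb{R}\cup\{+\infty\}$ and $g:\mathbb{R}^m\to\mathbb{R}\cup\{+\infty\}$ be proper lower semicontinuous convex functions, $A\in\mathbb{R}^{m\times n}$, and $\mathcal{L}(x,\lambda)=f(x)-\lambda^TAx-g^*(\lambda)$. Suppose that $f$ and $g^*$ are both $L$-smooth convex functions (in particular finite everywhere) for a constant $L>0$. Let $0<\eta\le1/(L+\|A\|_2)$ and let $z^k=(x^k,\lambda^k)$, $k\ge0$, be generated by the linearized primal-dual hybrid gradient method $$x^{k+1}=x^k-\eta\big(\nabla f(x^k)-A^T\lambda^k\big),\qquad\lambda^{k+1}=\lambda^k-\eta\big(\nabla g^*(\lambda^k)+A(2x^{k+1}-x^k)\big).$$ Set $\bar z^k=(\bar x^k,\bar\lambda^k)=\frac1k\sum_{i=1}^kz^i$. Then for every $k\ge1$ and every $z=(x,\lambda)\in\mathbb{R}^n\times\mathbb{R}^m$, $$\mathcal{L}(\bar x^k,\lambda)-\mathcal{L}(x,\bar\lambda^k)\le\frac{\|z-z^0\|_P^2}{2k},\qquad P=\begin{pmatrix}\frac1\eta I & A^T \\ A & \frac1\eta I\end{pmatrix}.$$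
   Context: $g^*(\lambda)=\max_y\{\lambda^Ty-g(y)\}$ (i.e. supremum) is the convex conjugate of $g$. A function is $L$-smooth if it is differentiable with $L$-Lipschitz continuous gradient (Euclidean norm). $\|A\|_2$ is the spectral norm and $\|z\|_P^2=z^TPz$. *)

(* Defs.v *)
(* MathComp-Analysis. Vectors of R^n are columns ['cV[R]_n]. The library norm on
   matrices is the max norm: it is used only through the (equivalent) topology,
   for lower semicontinuity and differentiability; every metric notion below is
   Euclidean. *)
From HB Require Import structures.
From mathcomp Require Import all_boot all_order all_algebra.
From mathcomp Require Import all_classical all_reals all_analysis.

Set Implicit Arguments.
Unset Strict Implicit.
Unset Printing Implicit Defensive.

Import Order.TTheory GRing.Theory Num.Theory.
Import numFieldNormedType.Exports.

Local Open Scope classical_set_scope.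
Local Open Scope ring_scope.

Definition dot (R : realType) (n : nat) (u v : 'cV[R]_n) : R :=
  (u^T *m v) 0 0.

Definition enorm (R : realType) (n : nat) (u : 'cV[R]_n) : R :=
  Num.sqrt (dot u u).

(* The norm of A induced by the Euclidean norms. *)
Definition spectral_norm (R : realType) (m n : nat) (A : 'M[R]_(m, n)) : R :=
  sup [set enorm (A *m x) | x in [set x : 'cV[R]_n | enorm x <= 1]].

Definition sqnorm_mx (R : realType) (n : nat) (P : 'M[R]_n) (z : 'cV[R]_n) : R :=
  (z^T *m P *m z) 0 0.

(* Values in R \cup {+oo}, not identically +oo. *)
Definition proper_fun (R : realType) (n : nat) (f : 'cV[R]_n -> \bar R) : Prop :=
  (forall x, f x != -oo%E) /\ exists x, f x != +oo%E.

(* For f with values in R \cup {+oo} the right-hand side is never oo - oo, and at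
   t = 0, 1 the convention 0 * +oo = 0 makes the inequality trivial. *)
Definition convex_fun (R : realType) (n : nat) (f : 'cV[R]_n -> \bar R) : Prop :=
  forall (x y : 'cV[R]_n) (t : R), 0 <= t <= 1 ->
    (f ((t *: x + (1 - t) *: y)%R) <= t%:E * f x + (1 - t)%:E * f y)%E.

Definition conv_conj (R : realType) (n : nat) (g : 'cV[R]_n -> \bar R)
    (lam : 'cV[R]_n) : \bar R :=
  ereal_sup [set ((dot lam y)%:E - g y)%E | y in [set: 'cV[R]_n]].

(* The vector of partial derivatives of the real-valued function [fine \o h];
   meaningful where h is finite and differentiable. *)
Definition grad (R : realType) (n : nat) (h : 'cV[R]_n -> \bar R)
    (x : 'cV[R]_n) : 'cV[R]_n :=
  \col_i 'D_(delta_mx i 0) (fine \o h) x.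

Definition smooth_fun (R : realType) (n : nat) (L : R)
    (h : 'cV[R]_n -> \bar R) : Prop :=
  [/\ forall x, h x \is a fin_num,
      forall x, differentiable (fine \o h) x &
      forall x y, enorm (grad h x - grad h y) <= L * enorm (x - y)].

Definition lagrangian (R : realType) (m n : nat) (f : 'cV[R]_n -> \bar R)
    (g : 'cV[R]_m -> \bar R) (A : 'M[R]_(m, n))
    (x : 'cV[R]_n) (lam : 'cV[R]_m) : \bar R :=
  (f x - (dot lam (A *m x))%:E - conv_conj g lam)%E.

Definition pdhg_mx (R : realType) (m n : nat) (eta : R) (A : 'M[R]_(m, n)) :
    'M[R]_(n + m) :=
  block_mx (eta^-1)%:M A^T A (eta^-1)%:M.

(* The index starts at 1: the initial point u 0 is not averaged. *)
Definition ergodic_mean (R : realType) (n : nat) (u : nat -> 'cV[R]_n) (k : nat) :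
    'cV[R]_n :=
  k%:R^-1 *: \sum_(1 <= i < k.+1) u i.

(* Main.v *)
Require Import Defs.
From HB Require Import structures.
From mathcomp Require Import all_boot all_order all_algebra.
From mathcomp Require Import all_classical all_reals all_analysis.
From mathcomp Require Import ring lra.
Import Order.TTheory GRing.Theory Num.Theory.
Import numFieldNormedType.Exports.
Local Open Scope classical_set_scope.
Local Open Scope ring_scope.

(** Writing d = z^{k+1} - z^k, the two updates say exactly that
      P d = - (grad f(x^k) - A^T lam^{k+1}, grad g^*(lam^k) + A x^{k+1}):
    the extrapolation 2 x^{k+1} - x^k is what makes the cross terms of P fit.
    So the method is a preconditioned proximal-point step in the metric P,
    except that the gradients are taken at the old point.  That delay costs
    L/2 |d|^2: smoothness bounds f(x^{k+1}) from above and convexity bounds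
    f(x') from below by the same linearization at x^k, hence
      f(x^{k+1}) - f(x') <= <grad f(x^k), x^{k+1} - x'> + L/2 |x^{k+1} - x^k|^2,
    and likewise for g^*.  Adding the two, the bilinear terms of the Lagrangian
    turn the linear part into - <P d, z^{k+1} - z>, which the three-point identity
    expands, giving
      L(x^{k+1}, lam) - L(x, lam^{k+1})
        <= (|z - z^k|_P^2 - |z - z^{k+1}|_P^2 - |d|_P^2 + L |d|^2) / 2.
    The step size condition reads 1/eta >= L + |A|, and this is what P >= L I
    requires ([pdhg_mx_coercive]), so the last two terms may be dropped
    ([pdhg_step]).  Summing over the iterations telescopes, the remaining
    -|z - z^k|_P^2 is nonpositive because P >= 0, and the gap at the averages is
    at most the average of the gaps by Jensen's inequality
    ([jensen_ergodic_mean]).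

    The properties of smooth convex functions used here all come from the
    two-sided second-order bound [smooth_taylor]: its upper half is the descent
    lemma, its lower half combined with convexity gives the gradient inequality
    [convex_gradient_ineq], and that one at the mean gives Jensen. *)

(** * The Euclidean inner product and norm *)

Lemma dotE {R : realType} {n : nat} (u v : 'cV[R]_n) :
  dot u v = \sum_i u i 0 * v i 0.
Proof. by rewrite /dot mxE; apply: eq_bigr => i _; rewrite mxE. Qed.

Lemma dotC {R : realType} {n : nat} (u v : 'cV[R]_n) : dot u v = dot v u.
Proof. by rewrite !dotE; apply: eq_bigr => i _; rewrite mulrC. Qed.

Lemma dotDl {R : realType} {n : nat} (u v w : 'cV[R]_n) :
  dot (u + v) w = dot u w + dot v w.
Proof. by rewrite /dot linearD mulmxDl mxE. Qed.

Lemma dotZl {R : realType} {n : nat} (a : R) (u w : 'cV[R]_n) :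
  dot (a *: u) w = a * dot u w.
Proof. by rewrite /dot linearZ -scalemxAl mxE. Qed.

Lemma dotNl {R : realType} {n : nat} (u w : 'cV[R]_n) : dot (- u) w = - dot u w.
Proof. by rewrite -scaleN1r dotZl mulN1r. Qed.

Lemma dotDr {R : realType} {n : nat} (u v w : 'cV[R]_n) :
  dot w (u + v) = dot w u + dot w v.
Proof. by rewrite !(dotC w) dotDl. Qed.

Lemma dotZr {R : realType} {n : nat} (a : R) (u w : 'cV[R]_n) :
  dot w (a *: u) = a * dot w u.
Proof. by rewrite !(dotC w) dotZl. Qed.

Lemma dotNr {R : realType} {n : nat} (u w : 'cV[R]_n) : dot w (- u) = - dot w u.
Proof. by rewrite !(dotC w) dotNl. Qed.

Lemma dot_trmx {R : realType} {m n : nat} (A : 'M[R]_(m, n))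
    (u : 'cV[R]_m) (v : 'cV[R]_n) : dot (A^T *m u) v = dot u (A *m v).
Proof. by rewrite /dot trmx_mul trmxK mulmxA. Qed.

Definition dot_bilinear {R : realType} {n : nat} :=
  (@dotDl R n, @dotDr R n, @dotNl R n, @dotNr R n, @dotZl R n, @dotZr R n).

Lemma dot0l {R : realType} {n : nat} (v : 'cV[R]_n) : dot 0 v = 0.
Proof. by rewrite -(scale0r 0) dotZl mul0r. Qed.

Lemma dot_ge0 {R : realType} {n : nat} (u : 'cV[R]_n) : 0 <= dot u u.
Proof. by rewrite dotE; apply: sumr_ge0 => i _; rewrite -expr2 sqr_ge0. Qed.

Lemma dot_eq0 {R : realType} {n : nat} (u : 'cV[R]_n) : dot u u = 0 -> u = 0.
Proof.
rewrite dotE => /eqP; rewrite psumr_eq0 => [/allP u0|i _]; last first.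
  by rewrite -expr2 sqr_ge0.
apply/colP => i; rewrite mxE; apply/eqP.
by have := u0 i (mem_index_enum _); rewrite /= mulf_eq0 orbb.
Qed.

(** Expand |<v,v> u - <u,v> v|^2 >= 0 and divide by <v,v>; if <v,v> = 0 then
    v = 0. *)
Lemma CauchySchwarz_sqr {R : realType} {n : nat} (u v : 'cV[R]_n) :
  dot u v ^+ 2 <= dot u u * dot v v.
Proof.
have [/dot_eq0 ->|v0] := eqVneq (dot v v) 0.
  by rewrite dotC !dot0l expr0n mulr0.
have vgt0 : 0 < dot v v by rewrite lt_def v0 dot_ge0.
have := dot_ge0 (dot v v *: u - dot u v *: v).
rewrite !dot_bilinear (dotC v u).
rewrite (_ : _ + _ = dot v v * (dot u u * dot v v - dot u v ^+ 2)); last by ring.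
by rewrite pmulr_rge0 // subr_ge0.
Qed.

Lemma enorm_ge0 {R : realType} {n : nat} (u : 'cV[R]_n) : 0 <= enorm u.
Proof. exact: sqrtr_ge0. Qed.

Lemma sqr_enorm {R : realType} {n : nat} (u : 'cV[R]_n) : enorm u ^+ 2 = dot u u.
Proof. by rewrite sqr_sqrtr ?dot_ge0. Qed.

Lemma enormZ {R : realType} {n : nat} (a : R) (u : 'cV[R]_n) :
  enorm (a *: u) = `|a| * enorm u.
Proof.
by rewrite /enorm !dot_bilinear mulrA -expr2 sqrtrM ?sqr_ge0// sqrtr_sqr.
Qed.

Lemma CauchySchwarz {R : realType} {n : nat} (u v : 'cV[R]_n) :
  `|dot u v| <= enorm u * enorm v.
Proof.
rewrite /enorm -sqrtrM ?dot_ge0// -sqrtr_sqr.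
exact/ler_wsqrtr/CauchySchwarz_sqr.
Qed.

(** * The spectral norm *)

(** The supremum of an unbounded set is a junk value, so boundedness has to be
    established before the spectral norm means anything.  By Cauchy-Schwarz on
    each row, the Frobenius norm is a bound. *)
Lemma spectral_norm_has_ubound {R : realType} {m n : nat} (A : 'M[R]_(m, n)) :
  has_ubound [set enorm (A *m x) | x in [set x : 'cV[R]_n | enorm x <= 1]].
Proof.
exists (Num.sqrt (\sum_i dot (row i A)^T (row i A)^T)) => _ [x /= x1 <-].
apply: ler_wsqrtr; rewrite (dotE (A *m x)); apply: ler_sum => i _.
have -> : (A *m x) i 0 = dot (row i A)^T x by rewrite /dot trmxK -row_mul [RHS]mxE.
rewrite -expr2 (le_trans (CauchySchwarz_sqr _ _))// ler_piMr ?dot_ge0//.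
by rewrite -sqr_enorm expr_le1// enorm_ge0.
Qed.

Lemma spectral_norm_ge0 {R : realType} {m n : nat} (A : 'M[R]_(m, n)) :
  0 <= spectral_norm A.
Proof.
rewrite (le_trans (enorm_ge0 (A *m 0)))//.
apply: ub_le_sup (spectral_norm_has_ubound A) _ _; exists 0 => //=.
by rewrite /enorm dot0l sqrtr0 ler01.
Qed.

Lemma enorm_mulmx_le {R : realType} {m n : nat} (A : 'M[R]_(m, n))
    (x : 'cV[R]_n) : enorm (A *m x) <= spectral_norm A * enorm x.
Proof.
have [x0|x0] := eqVneq (enorm x) 0.
  have -> : x = 0 by apply: dot_eq0; rewrite -sqr_enorm x0 expr0n.
  by rewrite mulmx0 /enorm !dot0l sqrtr0 mulr0.
have xgt0 : 0 < enorm x by rewrite lt_def x0 enorm_ge0.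
rewrite -ler_pdivrMr// mulrC.
have -> : (enorm x)^-1 * enorm (A *m x) = enorm (A *m ((enorm x)^-1 *: x)).
  by rewrite -scalemxAr enormZ ger0_norm// invr_ge0 ltW.
apply: ub_le_sup (spectral_norm_has_ubound A) _ _; exists ((enorm x)^-1 *: x) => //=.
by rewrite enormZ ger0_norm ?invr_ge0 ?enorm_ge0// mulVf.
Qed.

(** * Smooth and convex functions *)

Lemma grad_dot {R : realType} {n : nat} (h : 'cV[R]_n -> \bar R)
    (x d : 'cV[R]_n) :
  differentiable (fine \o h) x -> 'D_d (fine \o h) x = dot (grad h x) d.
Proof.
move=> hx; rewrite deriveE// [in LHS](matrix_sum_delta d) dotE linear_sum.
apply: eq_bigr => i _; rewrite big_ord1 linearZ /= mxE deriveE//.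
by rewrite mulrC.
Qed.

(** The two difference quotients are the same function of the increment, so
    no chain rule is needed. *)
Lemma is_derive_along_line {R : realType} {n : nat} (h : 'cV[R]_n -> \bar R)
    (x d : 'cV[R]_n) (t : R) :
  differentiable (fine \o h) (x + t *: d) ->
  is_derive t 1 (fun s : R => fine (h (x + s *: d))) (dot (grad h (x + t *: d)) d).
Proof.
move=> hx.
have e : (fun k : R => k^-1 *: (((fun s : R => fine (h (x + s *: d))) \o shift t) (k *: 1)
            - fine (h (x + t *: d))))
       = (fun k : R => k^-1 *: (((fine \o h) \o shift (x + t *: d)) (k *: d)
            - (fine \o h) (x + t *: d))).
  apply/funext => k /=; congr (_ *: (fine (h _) - _)).
  by rewrite /shift /= addrCA [k *: 1]mulr1 scalerDl.
apply: DeriveDef; first by rewrite /derivable e; exact: diff_derivable.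
by rewrite /derive e -grad_dot.
Qed.

(** The function t |-> phi t - phi'(0) t - c/2 t^2 has nonpositive derivative on
    [0, 1]; apply the mean value theorem to it. *)
Lemma le_quadratic_of_derive {R : realType} (phi dphi : R -> R) (c : R) :
  (forall t, is_derive t (1 : R) phi (dphi t)) ->
  (forall t, 0 <= t -> dphi t <= dphi 0 + c * t) ->
  phi 1 <= phi 0 + dphi 0 + c / 2%:R.
Proof.
move=> phid dphi_le.
pose psi t := phi t - (dphi 0 * t + c / 2%:R * t ^+ 2).
have psid t : is_derive t (1 : R) psi (dphi t - (dphi 0 + c * t)).
  (* The derivation of psi is found by instance search, from the derivative of phi. *)
  have phidt := phid t.
  by apply: is_derive_eq; rewrite /GRing.scale /=; field.
have [|s] := @MVT R psi _ 0 1 ltr01 (fun t _ => psid t).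
  by apply: derivable_within_continuous => t _; exact: ex_derive.
rewrite in_itv /= => /andP[s0 s1]; have := dphi_le s (ltW s0).
rewrite /psi => ? ?; lra.
Qed.

(** Restrict h to the line through x and y.  By Cauchy-Schwarz and the
    Lipschitz bound, the derivative of the restriction at t differs from the one
    at 0 by at most L |y - x|^2 t; the two sides of the bound come from
    [le_quadratic_of_derive] applied to the restriction and to its opposite. *)
Lemma smooth_taylor {R : realType} {n : nat} {L : R} {h : 'cV[R]_n -> \bar R}
    (x y : 'cV[R]_n) : smooth_fun L h ->
  `|fine (h y) - fine (h x) - dot (grad h x) (y - x)|
    <= L / 2%:R * dot (y - x) (y - x).
Proof.
move=> [_ hdiff hlip]; set d := y - x.
pose phi t := fine (h (x + t *: d)).
pose dphi t := dot (grad h (x + t *: d)) d.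
have phid t : is_derive t (1 : R) phi (dphi t) by exact: is_derive_along_line.
have dphi_le t : 0 <= t -> `|dphi t - dphi 0| <= L * dot d d * t.
  move=> t0; rewrite /dphi scale0r addr0 -dotNl -dotDl.
  rewrite (le_trans (CauchySchwarz _ _))//.
  have := ler_wpM2r (enorm_ge0 d) (hlip (x + t *: d) x).
  rewrite addrAC subrr add0r enormZ ger0_norm// => /le_trans; apply.
  by rewrite -sqr_enorm; rewrite le_eqVlt; apply/orP; left; apply/eqP; ring.
have phi0 : phi 0 = fine (h x) by rewrite /phi scale0r addr0.
have phi1 : phi 1 = fine (h y) by rewrite /phi scale1r addrC subrK.
have dphi0 : dphi 0 = dot (grad h x) d by rewrite /dphi scale0r addr0.
have up : phi 1 <= phi 0 + dphi 0 + L * dot d d / 2%:R.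
  apply: le_quadratic_of_derive => // t /dphi_le; rewrite ler_norml.
  by move=> /andP[_ ?]; lra.
have down : - phi 1 <= - phi 0 + - dphi 0 + L * dot d d / 2%:R.
  apply: (@le_quadratic_of_derive _ (- phi) (fun s => - dphi s)) => t.
  by move=> /dphi_le; rewrite ler_norml => /andP[? _]; lra.
by rewrite -phi0 -phi1 -dphi0 ler_norml; apply/andP; split; lra.
Qed.

(** At distance t along the segment, convexity bounds h from above by the
    chord and [smooth_taylor] bounds it from below by the tangent minus O(t^2).
    Dividing by t and letting t tend to 0 gives the inequality. *)
Lemma convex_gradient_ineq {R : realType} {n : nat} {L : R}
    {h : 'cV[R]_n -> \bar R} (x y : 'cV[R]_n) :
  smooth_fun L h -> convex_fun h ->
  fine (h x) + dot (grad h x) (y - x) <= fine (h y).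
Proof.
move=> hs hc; have [hfin _ _] := hs.
set d := y - x; set c := L / 2%:R * dot d d.
have bound t : 0 < t <= 1 ->
    fine (h x) + dot (grad h x) d <= fine (h y) + c * t.
  move=> /andP[t0 t1].
  have := hc y x t; rewrite (ltW t0) t1 => /(_ isT).
  rewrite -(fineK (hfin y)) -(fineK (hfin x)) -(fineK (hfin (_ + _))).
  rewrite -!EFinM -EFinD lee_fin => hconv.
  have := smooth_taylor x (x + t *: d) hs; rewrite ler_norml => /andP[+ _].
  rewrite addrAC subrr add0r !dotZr dotZl => low.
  have e : t *: y + (1 - t) *: x = x + t *: d.
    by rewrite scalerBl scale1r scalerBr addrCA addrA.
  move: hconv low; rewrite e => hconv low.
  rewrite -(ler_pM2l t0) /c /=; lra.
have [c0|c0] := leP c 0.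
  by have := bound 1; rewrite ltr01 lexx mulr1 => /(_ isT) ?; lra.
apply/ler_addgt0Pr => e e0.
(* This t makes the error c * t at most e while staying in the segment. *)
pose t := Num.min 1 (e / c).
have t0 : 0 < t by rewrite lt_min ltr01 divr_gt0.
have t1 : t <= 1 by rewrite ge_min lexx.
have te : c * t <= e.
  by rewrite mulrC -ler_pdivlMr// /t ge_min lexx orbT.
have := bound t; rewrite t0 t1 => /(_ isT) ?; lra.
Qed.

(** * Averages of the iterates *)

Lemma ergodic_mean_sum {R : realType} {n : nat} (u : nat -> 'cV[R]_n) (k : nat) :
  (0 < k)%N -> k%:R *: ergodic_mean u k = \sum_(1 <= i < k.+1) u i.
Proof. by move=> k0; rewrite scalerA mulfV ?scale1r// pnatr_eq0 -lt0n. Qed.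

Lemma sum_dot_ergodic_mean {R : realType} {n : nat} (v : 'cV[R]_n)
    (u : nat -> 'cV[R]_n) (k : nat) : (0 < k)%N ->
  \sum_(1 <= i < k.+1) dot v (u i) = k%:R * dot v (ergodic_mean u k).
Proof.
move=> k0; rewrite -dotZr ergodic_mean_sum//.
elim/big_rec2: _ => [|i a b _ ->]; last by rewrite dotDr.
by rewrite dotC dot0l.
Qed.

Lemma sum_cst_shifted {R : realType} (c : R) (k : nat) :
  \sum_(1 <= i < k.+1) c = k%:R * c.
Proof. by rewrite sumr_const_nat subn1 mulr_natl. Qed.

(** Sum the gradient inequalities based at the mean v: the linear terms cancel
    because the u i - v sum to 0. *)
Lemma jensen_ergodic_mean {R : realType} {n : nat} {L : R}
    {h : 'cV[R]_n -> \bar R} (u : nat -> 'cV[R]_n) (k : nat) :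
  smooth_fun L h -> convex_fun h -> (0 < k)%N ->
  k%:R * fine (h (ergodic_mean u k)) <= \sum_(1 <= i < k.+1) fine (h (u i)).
Proof.
move=> hs hc k0; set v := ergodic_mean u k.
have -> : k%:R * fine (h v) =
    \sum_(1 <= i < k.+1) (fine (h v) + dot (grad h v) (u i - v)).
  under eq_bigr do rewrite dotDr dotNr.
  by rewrite big_split sumrB !sum_cst_shifted sum_dot_ergodic_mean//= subrr addr0.
by apply: ler_sum => i _; exact: convex_gradient_ineq hs hc.
Qed.

(** * The metric of the method *)

Lemma sqnorm_pdhg {R : realType} {m n : nat} (eta : R) (A : 'M[R]_(m, n))
    (a : 'cV[R]_n) (b : 'cV[R]_m) :
  sqnorm_mx (pdhg_mx eta A) (col_mx a b) =
    eta^-1 * (dot a a + dot b b) + 2%:R * dot b (A *m a).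
Proof.
rewrite /sqnorm_mx /pdhg_mx tr_col_mx mul_row_block mul_row_col.
have diagE p (c : 'cV[R]_p) : c^T *m (eta^-1)%:M *m c = eta^-1 *: (c^T *m c).
  by rewrite mul_mx_scalar -scalemxAl.
rewrite !mulmxDl !diagE -trmx_mul -(mulmxA b^T).
have addE (M N : 'M[R]_1) : (M + N) 0 0 = M 0 0 + N 0 0 by rewrite mxE.
have scaleE (M : 'M[R]_1) : (eta^-1 *: M) 0 0 = eta^-1 * M 0 0 by rewrite mxE.
rewrite !addE !scaleE -!/(dot _ _) (dotC (A *m a)).
ring.
Qed.

(** P >= L I: the cross term 2 <b, A a> is at least - |A| (|a|^2 + |b|^2) by
    Cauchy-Schwarz and 2 |a| |b| <= |a|^2 + |b|^2, and the step size condition is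
    1/eta - |A| >= L. *)
Lemma pdhg_mx_coercive {R : realType} {m n : nat} {L eta : R}
    {A : 'M[R]_(m, n)} (a : 'cV[R]_n) (b : 'cV[R]_m) :
  0 < L -> 0 < eta -> eta <= 1 / (L + spectral_norm A) ->
  L * (dot a a + dot b b) <= sqnorm_mx (pdhg_mx eta A) (col_mx a b).
Proof.
move=> L0 eta0 etaL; rewrite sqnorm_pdhg.
have S0 := spectral_norm_ge0 A.
have LS0 : 0 < L + spectral_norm A by rewrite ltr_wpDr.
have inv_eta : L + spectral_norm A <= eta^-1.
  by move: etaL; rewrite div1r -[X in X <= _]invrK lef_pV2 ?posrE ?invr_gt0.
have cross : - (spectral_norm A * (dot a a + dot b b)) <= 2%:R * dot b (A *m a).
  have := CauchySchwarz b (A *m a); rewrite ler_norml => /andP[+ _].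
  have := ler_wpM2l (enorm_ge0 b) (enorm_mulmx_le A a).
  have := mulr_ge0 S0 (sqr_ge0 (enorm a - enorm b)).
  rewrite -!sqr_enorm => ? ? ?; lra.
have ab0 : 0 <= dot a a + dot b b by rewrite addr_ge0 ?dot_ge0.
have := ler_wpM2r ab0 inv_eta => ?; lra.
Qed.

(** * One iteration, and the ergodic rate *)

(** The updates determine both gradients as affine functions of the iterates.
    After substitution the claim is a linear combination of the descent lemma and
    the gradient inequality for f and h, and of P >= L I at (x1 - x0, l1 - l0);
    the identity behind it is the three-point identity for P. *)
Lemma pdhg_step {R : realType} {m n : nat} {L eta : R}
    {f : 'cV[R]_n -> \bar R} {h : 'cV[R]_m -> \bar R} {A : 'M[R]_(m, n)}
    {x0 x1 : 'cV[R]_n} {l0 l1 : 'cV[R]_m} (p : 'cV[R]_n) (l : 'cV[R]_m) :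
  0 < L -> 0 < eta -> eta <= 1 / (L + spectral_norm A) ->
  smooth_fun L f -> convex_fun f -> smooth_fun L h -> convex_fun h ->
  x1 = x0 - eta *: (grad f x0 - A^T *m l0) ->
  l1 = l0 - eta *: (grad h l0 + A *m (2%:R *: x1 - x0)) ->
  fine (f x1) - fine (f p) + (fine (h l1) - fine (h l))
    - dot l (A *m x1) + dot l1 (A *m p)
  <= (sqnorm_mx (pdhg_mx eta A) (col_mx (p - x0) (l - l0))
      - sqnorm_mx (pdhg_mx eta A) (col_mx (p - x1) (l - l1))) / 2%:R.
Proof.
move=> L0 eta0 etaL fs fc hs hc stepx stepl.
have eta_neq0 : eta != 0 by rewrite gt_eqF.
have gradf : grad f x0 = A^T *m l0 - eta^-1 *: (x1 - x0).
  rewrite stepx addrAC subrr add0r scalerN scalerA mulVf// scale1r opprK.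
  by rewrite addrC subrK.
have gradh : grad h l0 = - (eta^-1 *: (l1 - l0)) - A *m (2%:R *: x1 - x0).
  rewrite {1}stepl addrAC subrr add0r scalerN scalerA mulVf// scale1r opprK.
  by rewrite addrK.
have := smooth_taylor x0 x1 fs; rewrite ler_norml => /andP[_].
have := smooth_taylor l0 l1 hs; rewrite ler_norml => /andP[_].
have := convex_gradient_ineq x0 p fs fc.
have := convex_gradient_ineq l0 l hs hc.
have := pdhg_mx_coercive (x1 - x0) (l1 - l0) L0 eta0 etaL.
rewrite !sqnorm_pdhg gradf gradh.
(* Reduce everything to inner products of the points, in one order, so that the
   combination is linear in these atoms. *)
rewrite !(mulmxBr, mulmxDr) -!scalemxAr !(dot_bilinear, dot_trmx).
rewrite (dotC x1 x0) (dotC p x0) (dotC p x1) (dotC l1 l0) (dotC l l0) (dotC l l1).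
rewrite !(dotC (A *m _)).
move=> ? ? ? ? ?; lra.
Qed.

Theorem corollary5 (R : realType) (n m : nat)
    (f : 'cV[R]_n -> \bar R) (g : 'cV[R]_m -> \bar R) (A : 'M[R]_(m, n))
    (L eta : R) (x : nat -> 'cV[R]_n) (lam : nat -> 'cV[R]_m)
    (f_proper : proper_fun f) (f_lsc : lower_semicontinuous f)
    (f_convex : convex_fun f)
    (g_proper : proper_fun g) (g_lsc : lower_semicontinuous g)
    (g_convex : convex_fun g)
    (L_gt0 : 0 < L)
    (f_smooth : smooth_fun L f)
    (gconj_smooth : smooth_fun L (conv_conj g))
    (gconj_convex : convex_fun (conv_conj g))
    (eta_gt0 : 0 < eta) (eta_le : eta <= 1 / (L + spectral_norm A))
    (x_step : forall k : nat,
      x k.+1 = x k - eta *: (grad f (x k) - A^T *m lam k))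
    (lam_step : forall k : nat,
      lam k.+1 = lam k
        - eta *: (grad (conv_conj g) (lam k) + A *m (2%:R *: x k.+1 - x k))) :
  forall (k : nat), (1 <= k)%N ->
  forall (x' : 'cV[R]_n) (lam' : 'cV[R]_m),
    (lagrangian f g A (ergodic_mean x k) lam'
       - lagrangian f g A x' (ergodic_mean lam k)
     <= (sqnorm_mx (pdhg_mx eta A)
           (col_mx x' lam' - col_mx (x 0%N) (lam 0%N))%R / (2%:R * k%:R))%:E)%E.
Proof.
move=> k k0 p l.
have [ffin _ _] := f_smooth; have [hfin _ _] := gconj_smooth.
pose h := conv_conj g.
pose q i := sqnorm_mx (pdhg_mx eta A) (col_mx (p - x i) (l - lam i)).
have q_ge0 i : 0 <= q i.
  apply: le_trans (pdhg_mx_coercive _ _ L_gt0 eta_gt0 eta_le).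
  by rewrite mulr_ge0 ?addr_ge0 ?dot_ge0// ltW.
pose gap i := fine (f (x i)) - fine (f p) + (fine (h (lam i)) - fine (h l))
    - dot l (A *m x i) + dot (lam i) (A *m p).
have sum_gap : \sum_(1 <= i < k.+1) gap i <= q 0%N / 2%:R.
  (* The distances to z telescope. *)
  have -> : q 0%N / 2%:R = \sum_(1 <= i < k.+1) (q i.-1 - q i) / 2%:R + q k / 2%:R.
    rewrite big_add1 /= (telescope_sumr_eq (fun i => - q i / 2%:R))//; last first.
      by move=> i _; ring.
    by ring.
  apply: ler_wpDr; first by rewrite divr_ge0 ?q_ge0.
  rewrite !big_nat; apply: ler_sum => -[//|i] _.
  exact: (pdhg_step p l L_gt0 eta_gt0 eta_le f_smooth f_convex gconj_smooth
            gconj_convex (x_step i) (lam_step i)).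
set xm := ergodic_mean x k; set lm := ergodic_mean lam k.
have k_gt0 : 0 < k%:R :> R by rewrite ltr0n.
(* The gap is convex in (x i, lam i): its bilinear part is affine there. *)
have mean_gap : k%:R * (fine (f xm) - fine (f p) + (fine (h lm) - fine (h l))
    - dot l (A *m xm) + dot lm (A *m p)) <= \sum_(1 <= i < k.+1) gap i.
  rewrite /gap; under eq_bigr do rewrite -dot_trmx (dotC (lam _)).
  rewrite !(big_split, sumrN) /= !sum_cst_shifted !sum_dot_ergodic_mean//.
  rewrite -/xm -/lm dot_trmx (dotC (A *m p)).
  have := jensen_ergodic_mean x k f_smooth f_convex k0.
  have := jensen_ergodic_mean lam k gconj_smooth gconj_convex k0.
  rewrite -/xm -/lm -/h => ? ?; lra.
rewrite /lagrangian -(fineK (ffin xm)) -(fineK (ffin p)).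
rewrite -(fineK (hfin lm)) -(fineK (hfin l)) -/h -!EFinB lee_fin.
rewrite opp_col_mx add_col_mx -/(q 0%N) invfM mulrA ler_pdivlMr//.
move: (le_trans mean_gap sum_gap); rewrite mulrC; apply: le_trans.
by rewrite le_eqVlt; apply/orP; left; apply/eqP; ring.
Qed.
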